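(* Let $m\ge 1$ be a fixed integer. For a composition $\sigma=(a_1,\dots,a_k)$ (a finite sequence of positive integers, $k\ge 0$), let $|\sigma|=a_1+\cdots+a_k$, let $k$ be its number of parts, and let $\mathrm{st}_m(\sigma)$ be the number of indices $i$ with $1\le i\le k-m+1$ such that $a_{i+r-1}\ge r$ for every $r=1,\dots,m$ (the number of occurrences of the staircase $1^+2^+\cdots m^+$ in $\sigma$). Define the formal power series $$F=\sum_{\sigma} x^{|\sigma|}y^{k}q^{\mathrm{st}_m(\sigma)},$$ the sum running over all compositions $\sigma$ of all nonnegative integers (including the empty composition, which contributes $1$). For $n\ge 0$ put $$N_n=\sum_{j=0}^{n-1}x^{nj-\binom{j}{2}}\left(\frac{y}{1-x}\right)^{j}\qquad(\text{so }N_0=0).$$ Then $$F=\frac{N_{m}-\frac{qx^{m}y}{1-x}N_{m-1}}{(1-q)x^{\binom{m+1}{2}}\left(\frac{y}{1-x}\right)^{m}+\frac{1-x-xy}{1-x}\left(N_{m}-\frac{qx^{m}y}{1-x}N_{m-1}\right)}.$$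
   Context: A staircase $1^+2^+\cdots m^+$ is a word of $m$ consecutive parts in which, for $1\le i\le m$, the $i$th part is at least $i$; occurrences are counted as windows of consecutive parts of the composition. Here $x$ tracks the sum of the composition, $y$ the number of parts and $q$ the number of staircase occurrences. *)

(* Defs.v *)
From HB Require Import structures.
From mathcomp Require Import all_boot all_order all_algebra.
From mathcomp Require Import boolp classical_sets cardinality fsbigop.

Set Implicit Arguments.
Unset Strict Implicit.
Unset Printing Implicit Defensive.
Import GRing.Theory.
Local Open Scope ring_scope.

(* Formal power series in one variable over [R], as coefficient sequences. *)
Record fps (R : Type) := FPS { coefs : nat -> R }.

Lemma fpsP (R : Type) (f g : fps R) : (forall n, coefs f n = coefs g n) -> f = g.
Proof. by case: f g => [f] [g] /= fg; congr FPS; apply/funext. Qed.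

HB.instance Definition _ (R : Type) := gen_eqMixin (fps R).
HB.instance Definition _ (R : Type) := gen_choiceMixin (fps R).

Section Ring.
Variable R : comNzRingType.
Implicit Types f g h : fps R.

Definition fps_add f g := FPS (fun n => coefs f n + coefs g n).
Definition fps_opp f := FPS (fun n => - coefs f n).
Definition fpsC (c : R) := FPS (fun n => if n == 0%N then c else 0).
Definition fps_mul f g :=
  FPS (fun n => \sum_(j < n.+1) coefs f j * coefs g (n - j)).

Fact fps_addA : associative fps_add.
Proof. by move=> f g h; apply: fpsP => n /=; rewrite addrA. Qed.
Fact fps_addC : commutative fps_add.
Proof. by move=> f g; apply: fpsP => n /=; rewrite addrC. Qed.
Fact fps_add0 : left_id (fpsC 0) fps_add.
Proof. by move=> f; apply: fpsP => n /=; rewrite if_same add0r. Qed.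
Fact fps_addN : left_inverse (fpsC 0) fps_opp fps_add.
Proof. by move=> f; apply: fpsP => n /=; rewrite if_same addNr. Qed.

HB.instance Definition _ := GRing.isZmodule.Build (fps R)
  fps_addA fps_addC fps_add0 fps_addN.

Fact fps_mulC : commutative fps_mul.
Proof.
move=> f g; apply: fpsP => n /=; rewrite (reindex_inj rev_ord_inj) /=.
by apply: eq_bigr => j _; rewrite mulrC subSS (sub_ordK j).
Qed.

(* A coefficient of a product is that of the product of polynomial truncations;
   associativity is inherited from polynomials. *)
Fact fps_mul_trunc f g N n : (n < N)%N ->
  coefs (fps_mul f g) n =
  ((\poly_(i < N) coefs f i) * (\poly_(i < N) coefs g i))`_n.
Proof.
move=> nN; rewrite coefM; apply: eq_bigr => j _; rewrite !coef_poly.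
by rewrite (leq_ltn_trans (leq_ord j) nN) (leq_ltn_trans (leq_subr j n) nN).
Qed.

Fact fps_mulA : associative fps_mul.
Proof.
move=> f g h; apply: fpsP => n.
pose T (u : fps R) := \poly_(i < n.+1) coefs u i.
have TM u v i : (i <= n)%N -> (T (fps_mul u v))`_i = (T u * T v)`_i.
  by move=> le_in; rewrite coef_poly ltnS le_in (@fps_mul_trunc _ _ n.+1).
rewrite !(@fps_mul_trunc _ _ n.+1) // -!/(T _).
transitivity ((T f * (T g * T h))`_n); last first.
  rewrite mulrA !coefM; apply: eq_bigr => j _.
  by congr (_ * _); rewrite TM // leq_ord.
by rewrite !coefM; apply: eq_bigr => j _; rewrite TM // leq_subr.
Qed.

Fact fps_mul1 : left_id (fpsC 1) fps_mul.
Proof.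
move=> f; apply: fpsP => n /=; rewrite big_ord_recl /= subn0 mul1r.
by rewrite big1 ?addr0 // => j _; rewrite mul0r.
Qed.

Fact fps_mulDl : left_distributive fps_mul +%R.
Proof.
move=> f g h; apply: fpsP => n /=; rewrite -big_split /=.
by apply: eq_bigr => j _; rewrite mulrDl.
Qed.

Fact fps_1_neq0 : fpsC 1 != 0 :> fps R.
Proof.
by apply/eqP => /(congr1 (fun f => coefs f 0)) /eqP; rewrite /= oner_eq0.
Qed.

HB.instance Definition _ := GRing.Zmodule_isComNzRing.Build (fps R)
  fps_mulA fps_mulC fps_mul1 fps_mulDl fps_1_neq0.

Lemma fps_coefM f g n :
  coefs (f * g) n = \sum_(j < n.+1) coefs f j * coefs g (n - j).
Proof. by []. Qed.

Definition fpsX : fps R := FPS (fun n => (n == 1%N)%:R).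

(* Sum of a family of power series, coefficient by coefficient; meaningful when
   for each n only finitely many members have a nonzero n-th coefficient
   (the finitely supported sum defaults to 0 otherwise). *)
Definition fps_sum (T : choiceType) (A : set T) (F : T -> fps R) : fps R :=
  FPS (fun n => (\sum_(t \in A) coefs (F t) n)%R).

End Ring.

Section UnitRing.
Variable R : comUnitRingType.
Implicit Types f g : fps R.

Definition fps_unit : pred (fps R) := fun f => coefs f 0 \is a GRing.unit.

(* The first n coefficients of the inverse of f, when [coefs f 0] is a unit. *)
Fixpoint fps_inv_seq f n : seq R :=
  if n is k.+1 then
    let s := fps_inv_seq f k in
    rcons s ((coefs f 0)^-1 *
             ((k == 0%N)%:R - \sum_(j < k) s`_j * coefs f (k - j)))
  else [::].

Definition fps_inv f : fps R :=
  if fps_unit f then FPS (fun n => (fps_inv_seq f n.+1)`_n) else f.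

Fact size_fps_inv_seq f n : size (fps_inv_seq f n) = n.
Proof. by elim: n => //= n IH; rewrite size_rcons IH. Qed.

Fact nth_fps_inv_seq f n i : (i < n)%N ->
  (fps_inv_seq f n)`_i = (fps_inv_seq f i.+1)`_i.
Proof.
elim: n => // n IH; rewrite ltnS leq_eqVlt => /orP[/eqP-> // | lt_in].
by rewrite [in LHS]/= nth_rcons size_fps_inv_seq lt_in IH.
Qed.

Fact fps_mulV : {in fps_unit, left_inverse 1 fps_inv *%R}.
Proof.
move=> f uf; apply: fpsP => n; rewrite /fps_inv (_ : fps_unit f = true) //.
rewrite [LHS]/= big_ord_recr /= subnn nth_rcons size_fps_inv_seq ltnn eqxx.
rewrite mulrC mulrA divrr // mul1r.
rewrite [X in X + _](eq_bigr (fun j : 'I_n =>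
  (fps_inv_seq f n)`_j * coefs f (n - j))) => [|j _].
  by rewrite addrC subrK; case: n.
by rewrite (nth_fps_inv_seq f (ltn_ord j)).
Qed.

Fact fps_unitPl f g : g * f = 1 -> fps_unit f.
Proof.
move=> /(congr1 (fun u => coefs u 0)); rewrite /= big_ord1 /= => gf1.
by apply/unitrPr; exists (coefs g 0); rewrite mulrC.
Qed.

Fact fps_inv_out : {in [predC fps_unit], fps_inv =1 id}.
Proof. by move=> f nuf; rewrite /fps_inv ifN. Qed.

HB.instance Definition _ := GRing.ComNzRing_hasMulInverse.Build (fps R)
  fps_mulV fps_unitPl fps_inv_out.

End UnitRing.

(* The series live in Z[q][y][[x]]: in each degree in x only finitely many
   compositions contribute, so the coefficients are polynomials in y and q. *)
Definition coefring : comUnitRingType := {poly {poly int}}.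

Definition x : fps coefring := fpsX coefring.
Definition y : fps coefring := fpsC ('X : coefring).
Definition q : fps coefring := fpsC ('X%:P : coefring).

Definition composition (s : seq nat) : bool := all (fun a => 0 < a)%N s.

(* Parts are indexed from 0, so the r-th part of the window starting at i
   (0 <= r < m) must be at least r.+1. The truncated [(size s).+1 - m] is 0 when
   s has fewer than m parts. *)
Definition st (m : nat) (s : seq nat) : nat :=
  #|[set i : 'I_((size s).+1 - m) |
      [forall r : 'I_m, (r.+1 <= nth 0 s (i + r))%N]]|.

Definition F (m : nat) : fps coefring :=
  fps_sum [set s : seq nat | composition s]%classic
    (fun s => x ^+ sumn s * y ^+ size s * q ^+ st m s).

(* The exponent is a genuine difference: 'C(j, 2) <= n * j for j < n. *)
Definition N (n : nat) : fps coefring :=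
  \sum_(j < n) x ^+ (n * j - 'C(j, 2)) * (y / (1 - x)) ^+ j.

Lemma onem_x_unit : 1 - x \is a GRing.unit.
Proof. by rewrite qualifE /= /fps_unit /= subr0 unitr1. Qed.

(* No default value is involved in the sum defining F. *)
Lemma finite_F_support m n :
  finite_set [set s : seq nat | composition s /\
    coefs (x ^+ sumn s * y ^+ size s * q ^+ st m s) n != 0]%classic.
Proof.
have xM (f : fps coefring) k i :
    coefs (x ^+ k * f) i = if (k <= i)%N then coefs f (i - k) else 0.
  elim: k i => [|k IH] i; first by rewrite expr0 mul1r subn0.
  rewrite exprS -mulrA fps_coefM; case: i => [|i].
    by rewrite big_ord1 mul0r.
  rewrite big_ord_recl [X in _ + X]big_ord_recl [X in _ + (_ + X)]big1 => [|j _].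
    by rewrite mul0r mul1r add0r addr0 (_ : lift _ _ = 1%N :> nat) // subn1 IH.
  by rewrite mul0r.
pose comps := [seq map val (tval u) | k <- iota 0 n.+1,
  u <- enum {: k.-tuple 'I_n.+1}].
apply: (@sub_finite_set _ _ [set` comps]%classic); last exact: finite_seq.
move=> s [s_pos]; rewrite -mulrA xM; case: leqP => [le_sn _|]; last by rewrite eqxx.
have size_le : (size s <= sumn s)%N.
  elim: s s_pos {le_sn} => //= a s IH /andP[a_pos /IH].
  by rewrite -(add1n (size s)) => ?; apply: leq_add.
have part_le a : a \in s -> (a < n.+1)%N.
  rewrite ltnS => sa; apply: leq_trans le_sn.
  by rewrite (perm_sumn (perm_to_rem sa)) leq_addr.
apply/allpairsPdep; exists (size s); exists (map_tuple inord (in_tuple s)).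
split; rewrite ?mem_enum //.
  by rewrite mem_iota /= add0n ltnS (leq_trans size_le).
rewrite /= -map_comp map_id_in // => a sa /=.
by rewrite inordK // part_le.
Qed.

(* Main.v *)
(** Reading the parts from left to right, let [s] be the largest length at most
    [m] of a suffix of the word read so far that is at least 1, 2, ..., [s] part
    by part. Reading a part [a] turns [s] into [min (s + 1, a, m)], and an
    occurrence of the staircase is completed exactly when the new value is [m].
    If [G s] counts the continuations of a word in state [s] and t = y / (1 - x),
    then consecutive differences satisfy
    [G s - G (s - 1) = x ^ (s + 1) t (G (s + 1) - G s)] for [s < m - 1] and
    [G (m - 1) - G (m - 2) = (q - 1) x ^ m t G (m - 1)].
    Hence every [G s] is an explicit multiple of [G (m - 1)]; in particular [G 0]
    is the numerator times [G (m - 1)], and [G 0 = 1 + x t G 1] says that the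
    denominator times [G (m - 1)] is 1. *)
Require Import Defs.
From mathcomp Require Import all_boot all_order all_algebra.
From mathcomp Require Import boolp classical_sets cardinality fsbigop.
From mathcomp Require Import zify ring.

Set Implicit Arguments.
Unset Strict Implicit.
Unset Printing Implicit Defensive.
Import GRing.Theory.
Local Open Scope ring_scope.

(** * Power series in one variable and sums over a leading part *)

Section PowerSeries.
Variable R : comNzRingType.
Implicit Types (f : fps R) (h : nat -> fps R).

Lemma coefD_fps f g n : coefs (f + g) n = coefs f n + coefs g n.
Proof. by []. Qed.

Lemma coef_fpsCM c f n : coefs (fpsC c * f) n = c * coefs f n.
Proof.
rewrite fps_coefM big_ord_recl /= subn0 big1 ?addr0 // => j _.
by rewrite mul0r.
Qed.

Lemma fpsCM (a b : R) : fpsC (a * b) = fpsC a * fpsC b.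
Proof.
by apply: fpsP => n; rewrite coef_fpsCM /=; case: eqP => // _; rewrite mulr0.
Qed.

Lemma fpsC_exp (c : R) n : fpsC c ^+ n = fpsC (c ^+ n).
Proof.
by elim: n => [|n IH]; rewrite ?expr0 // !exprS IH fpsCM.
Qed.

Lemma coef_fpsXM f n :
  coefs (fpsX R * f) n = if n is k.+1 then coefs f k else 0.
Proof.
rewrite fps_coefM; case: n => [|n]; first by rewrite big_ord1 mul0r.
rewrite !big_ord_recl big1 => [|j _]; last by rewrite mul0r.
by rewrite mul0r mul1r add0r addr0 subn1.
Qed.

Lemma coef_fpsXnM k f n :
  coefs (fpsX R ^+ k * f) n = if (k <= n)%N then coefs f (n - k) else 0.
Proof.
elim: k n => [|k IH] n; first by rewrite expr0 mul1r subn0.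
by rewrite exprS -mulrA coef_fpsXM; case: n => // n; rewrite IH.
Qed.

(* The series [\sum_(a >= 0) X ^+ a.+1 * h a]. *)
Definition shift_sum h : fps R :=
  FPS (fun n => \sum_(a < n) coefs (h a) (n - a.+1)).

Lemma eq_shift_sum h1 h2 : h1 =1 h2 -> shift_sum h1 = shift_sum h2.
Proof. by move=> /funext ->. Qed.

Lemma shift_sumS h :
  shift_sum h = fpsX R * (h 0%N + shift_sum (fun a => h a.+1)).
Proof.
apply: fpsP => n; rewrite coef_fpsXM; case: n => [|n]; first by rewrite /= big_ord0.
by rewrite coefD_fps /= big_ord_recl /= subn1.
Qed.

End PowerSeries.

Lemma onem_fpsX_unit (R : comUnitRingType) : 1 - fpsX R \is a GRing.unit.
Proof. by rewrite qualifE /= /fps_unit /= subr0 unitr1. Qed.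

(** Peeling off the first [b] terms leaves a constant family, whose sum is geometric: it satisfies
    [S = X (h b + S)], and [1 - X] is invertible. *)
Lemma shift_sum_stationary (R : comUnitRingType) (h : nat -> fps R) b :
    (forall a, (b <= a)%N -> h a = h b) ->
  shift_sum h =
    \sum_(a < b) fpsX R ^+ a.+1 * h a + fpsX R ^+ b.+1 / (1 - fpsX R) * h b.
Proof.
elim: b h => [|b IH] h hb.
  rewrite big_ord0 add0r expr1; apply: (mulrI (onem_fpsX_unit R)).
  rewrite !mulrA [_ * fpsX R]mulrC mulrK ?onem_fpsX_unit //.
  rewrite mulrBl mul1r {1}shift_sumS mulrDr.
  by rewrite (@eq_shift_sum _ _ h) ?addrK // => a; rewrite hb // [RHS]hb.
rewrite shift_sumS (IH (fun a => h a.+1)) => [|a ba]; last exact: hb.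
rewrite big_ord_recl expr1 !mulrDr mulr_sumr !mulrA -exprS addrA.
congr (_ + _ + _).
by apply: eq_bigr => a _; rewrite mulrA -exprS.
Qed.

(** * Enumeration of compositions and their weighted series *)

(* The first argument is fuel: it has to be at least [n]. *)
Fixpoint comps k n : seq (seq nat) :=
  if (k, n) is (k'.+1, _.+1) then
    [seq a.+1 :: s | a <- iota 0 n, s <- comps k' (n - a.+1)%N]
  else [:: [::]].

Lemma compsS k n : comps k.+1 n.+1 =
  [seq a.+1 :: s | a <- iota 0 n.+1, s <- comps k (n - a)%N].
Proof. by []. Qed.

Lemma mem_comps k n s : (n <= k)%N ->
  (s \in comps k n) = composition s && (sumn s == n).
Proof.
elim: k n s => [|k IH] [|n] s.
- by case: s => [|[|a] s] //=; rewrite andbF.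
- by [].
- by case: s => [|[|a] s] //=; rewrite andbF.
rewrite ltnS compsS => nk; apply/allpairsPdep/idP.
  move=> [a [u []]]; rewrite mem_iota => an.
  by rewrite IH => [/andP[uc /eqP us] ->|]; rewrite /= ?uc /=; lia.
case: s => [|[|a] s] // /andP[sc /eqP ss]; rewrite [sumn _]/= in ss.
by exists a, s; rewrite mem_iota IH ?[composition s]sc; [split=> //; lia | lia].
Qed.

Lemma uniq_comps k n : uniq (comps k n).
Proof.
elim: k n => [|k IH] [|n] //; rewrite compsS.
apply: allpairs_uniq_dep => [|a _|]; rewrite ?iota_uniq //.
by move=> [a s] [b u] _ _ [-> ->].
Qed.

Section CompositionSeries.
Variable R : comNzRingType.
Implicit Types c : seq nat -> R.

(** Only x is a series variable; the weight [c] lies in the coefficient ring, where y and q are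
    constants. *)
Definition comp_series c : fps R :=
  fps_sum [set s : seq nat | composition s]%classic
    (fun s => fpsX R ^+ sumn s * fpsC (c s)).

(** Only compositions of [n] reach degree [n], so the finitely supported sum becomes a sum over a
    list, which can be split by first part. *)
Lemma coef_comp_series c k n : (n <= k)%N ->
  coefs (comp_series c) n = \sum_(s <- comps k n) c s.
Proof.
move=> nk.
have cE s : coefs (fpsX R ^+ sumn s * fpsC (c s)) n = if sumn s == n then c s else 0.
  by rewrite coef_fpsXnM /= subn_eq0 eqn_leq; case: leqP.
transitivity (\sum_(s \in [set` comps k n]%classic) c s)%R; last first.
  by rewrite -(fsbig_seq _ _ (uniq_comps k n)).
rewrite /comp_series /fps_sum /=.
transitivity (\sum_(s \in [set` comps k n]%classic)
    coefs (fpsX R ^+ sumn s * fpsC (c s)) n)%R.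
  apply/esym/fsbig_widen => [s /=|s /=]; rewrite mem_comps //; first by case/andP.
  by move=> [sc /negP]; rewrite sc /= => /negbTE ns; apply: etrans (cE s) _; rewrite ns.
apply: eq_fsbigr => s; rewrite inE [X in X -> _]/= mem_comps // => /andP[_ sn].
by rewrite cE sn.
Qed.

Lemma comp_series_cons c :
  comp_series c =
    fpsC (c [::]) + shift_sum (fun a => comp_series (fun s => c (a.+1 :: s))).
Proof.
apply: fpsP => n; rewrite (coef_comp_series c (leqnn n)) coefD_fps.
case: n => [|n]; first by rewrite /= big_ord0 big_seq1 addr0.
rewrite [coefs (fpsC _) _]/= add0r compsS big_allpairs_dep.
rewrite -[iota 0 n.+1]/(index_iota 0 n.+1) big_mkord; apply: eq_bigr => a _.
by rewrite (@coef_comp_series _ n) // subSS leq_subr.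
Qed.

Lemma comp_seriesZ b c : comp_series (fun s => b * c s) = fpsC b * comp_series c.
Proof.
apply: fpsP => n; rewrite coef_fpsCM !(coef_comp_series _ (leqnn n)).
by rewrite mulr_sumr.
Qed.

End CompositionSeries.

(** * The automaton that detects staircases *)

Definition next_state m s a : nat := minn (minn s.+1 a) m.

Fixpoint occ m s (u : seq nat) : nat :=
  if u is a :: v then ((next_state m s a == m) + occ m (next_state m s a) v)%N else 0%N.

(* The state after [k.+1] parts is the minimum of [m], [s + k.+1] and all
   [nth 0 u j + (k - j)] for [j <= k]. *)
Lemma occE m s u :
  occ m s u = (\sum_(k < size u)
    ((m <= s + k.+1) && [forall j : 'I_k.+1, m <= nth 0 u j + (k - j)]))%N.
Proof.
elim: u s => [|a u IH] s /=; first by rewrite big_ord0.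
rewrite big_ord_recl; congr (_ + _)%N.
  congr nat_of_bool; apply/idP/andP => [|[sm /forallP /(_ ord0)]] /=.
    rewrite /next_state => ns; split; first by lia.
    by apply/forallP => j; rewrite ord1 /=; lia.
  by move: sm; rewrite /next_state /=; lia.
rewrite IH; apply: eq_bigr => k _; congr nat_of_bool.
rewrite /next_state /= -[bump 0 k]/k.+1.
apply/andP/andP => [] [sm /forallP uP]; split; first by lia.
- apply/forallP => -[[|j] jk] /=; first by lia.
  exact: uP (Ordinal (jk : (j < k.+1)%N)).
- by have /= := uP ord0; lia.
- by apply/forallP => j; apply: uP (lift ord0 j).
Qed.

(** Each window is matched with the position of its last part, the moment at which the automaton
    completes it. *)
Lemma st_occ m u : (0 < m)%N -> st m u = occ m 0 u.
Proof.
case: m => // m _; rewrite occE /st -sum1dep_card big_mkcond /=.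
rewrite -(big_mkord xpredT (fun k => ((m.+1 <= 0 + k.+1) &&
  [forall j : 'I_k.+1, m.+1 <= nth 0 u j + (k - j)])%N : nat)).
have [um|mu] := ltnP (size u) m.
  rewrite [RHS]big_nat [RHS]big1 => [|k /andP[_ ku]].
    by move: (ltnW um); rewrite subSS -subn_eq0 => /eqP ->; rewrite big_ord0.
  by rewrite ltnS (leqNgt m k) (leq_trans ku (ltnW um)).
rewrite (big_cat_nat (n := m)) //= [X in (X + _)%N]big_nat [X in (X + _)%N]big1 => [|k /andP[_ km]].
  rewrite add0n -[X in (\sum_(X <= _ < _) _)%N](add0n m) big_addn subSS big_mkord.
  apply: eq_bigr => i _; rewrite [RHS](_ : _ = nat_of_bool
    [forall r : 'I_m.+1, r.+1 <= nth 0 u (i + r)]%N); first by case: ifP.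
  rewrite add0n ltnS leq_addl andTb; congr nat_of_bool.
  apply/forallP/forallP => /= uP j.
    have jm : (i + j < (i + m).+1)%N by rewrite ltnS leq_add2l -ltnS.
    by have /= := uP (Ordinal jm); have := ltn_ord j; lia.
  (* A position [j] before the window imposes nothing, since [i + m - j] already exceeds [m]. *)
  have [ji|ij] := ltnP j i; first by lia.
  have jm : (j - i < m.+1)%N by have := ltn_ord j; lia.
  by have /= := uP (Ordinal jm); rewrite subnKC //; lia.
by rewrite ltnS leqNgt km.
Qed.

(** * Arithmetic of the exponents in [N] *)

Lemma bin2_leq_sqr j : ('C(j, 2) <= j * j)%N.
Proof. by elim: j => // j; rewrite binS bin1; lia. Qed.

(** The increment [n - j] is, for [n = m.+1], the power of x gained at each step down the chain of
    differences of [G]. *)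
Lemma exponentS n j : (j < n)%N ->
  (n * j.+1 - 'C(j.+1, 2) = n * j - 'C(j, 2) + (n - j))%N.
Proof.
by move=> jn; have := bin2_leq_sqr j; rewrite binS bin1 mulnS; nia.
Qed.

Lemma exponent_shift n j : (j < n)%N ->
  (n.+1 * j.+1 - 'C(j.+1, 2) = n.+1 + (n * j - 'C(j, 2)))%N.
Proof.
by move=> jn; have := bin2_leq_sqr j; rewrite binS bin1 !mulSn mulnS; nia.
Qed.

Lemma exponent_diag n : (n * n - 'C(n, 2) = 'C(n.+1, 2))%N.
Proof.
have : (2 * 'C(n, 2) + n = n * n)%N by elim: n => // n; rewrite binS bin1; lia.
by rewrite binS bin1; lia.
Qed.

(** * The linear system of the states, for a staircase of length [m.+1] *)

Section LinearSystem.
Variables (A : comNzRingType) (x t q : A) (m : nat) (G : nat -> A).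

Let S n : A := \sum_(j < n) x ^+ (n * j - 'C(j, 2)) * t ^+ j.

Hypothesis G_last : G m.+1 = G m.
(** The product [t * (1 - x)] stands for y, which keeps the system free of division; [x ^+ s.+1 * t]
    collects all parts greater than [s]. *)
Hypothesis G_rec : forall s, (s <= m)%N ->
  G s = 1 + \sum_(a < s) x ^+ a.+1 * (t * (1 - x) * G a.+1)
          + x ^+ s.+1 * t * ((if s == m then q else 1) * G s.+1).

(** The new summand for the part [s.+1] combines with the old tail: [x ^+ s.+1 * t * (1 - x) - x ^+
    s.+1 * t = - x ^+ s.+2 * t]. *)
Let G_diff s : (s.+1 < m)%N ->
  G s.+1 - G s = x ^+ s.+2 * t * (G s.+2 - G s.+1).
Proof.
move=> sm; rewrite [in X in X - _](G_rec (ltnW sm)) (G_rec (ltnW (ltnW sm))).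
rewrite big_ord_recr /= !ltn_eqF //; last exact: ltnW.
by rewrite [x ^+ s.+2]exprS; ring.
Qed.

Let G_diff_last s : m = s.+1 -> G s.+1 - G s = (q - 1) * (x ^+ s.+2 * t) * G s.+1.
Proof.
move=> ms; have sm : (s < m)%N by rewrite ms.
rewrite [in X in X - _](G_rec sm) (G_rec (ltnW sm)).
rewrite big_ord_recr /= (ltn_eqF sm) -ms eqxx G_last [x ^+ m.+1]exprS.
by ring.
Qed.

(** Descending from [G m], the factors [x ^+ m.+1], [x ^+ m], ... multiply up to the monomials of
    [S m.+1]. *)
Let G_step j : (j < m)%N ->
  G (m - j) - G (m - j.+1) =
  (q - 1) * (x ^+ (m.+1 * j.+1 - 'C(j.+1, 2)) * t ^+ j.+1) * G m.
Proof.
elim: j => [|j IH] jm.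
  rewrite subn0 subn1 muln1 subn0; case: m jm (@G_diff_last) => // k _ D.
  by rewrite (D k) // expr1.
rewrite exponentS ?exprD; last by rewrite ltnS ltnW // ltnW.
have mj : (m - j = (m - j.+2).+2)%N by lia.
rewrite subSS mj subnSK // -subnSK // G_diff; last by lia.
have := IH (ltnW jm); rewrite mj -[(m - j.+1)%N]subnSK // => ->.
by rewrite [t ^+ j.+2]exprS; ring.
Qed.

(** Telescoping [G_step] gives [G 0] as a multiple of [G m]. The second identity exhibits [G m] as
    the inverse of the denominator. *)
Lemma staircase_system : let num := S m.+1 - q * x ^+ m.+1 * t * S m in
  G 0%N = num * G m /\
  ((1 - q) * x ^+ 'C(m.+2, 2) * t ^+ m.+1 + (1 - x * t) * num) * G m = 1.
Proof.
have SE : S m.+1 = 1 + x ^+ m.+1 * t * S m.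
  rewrite /S big_ord_recl muln0 mulr1 mulr_sumr; congr (_ + _).
  apply: eq_bigr => j _; rewrite lift0 exponent_shift // exprD [t ^+ j.+1]exprS; ring.
have S_recl : S m.+1 =
    1 + \sum_(i < m) x ^+ (m.+1 * i.+1 - 'C(i.+1, 2)) * t ^+ i.+1.
  by rewrite /S big_ord_recl muln0 mulr1.
have G_sub j : (j <= m)%N -> G (m - j) =
    (1 + (1 - q) * \sum_(i < j) x ^+ (m.+1 * i.+1 - 'C(i.+1, 2)) * t ^+ i.+1) * G m.
  elim: j => [|j IH] jm; first by rewrite big_ord0 mulr0 addr0 mul1r subn0.
  rewrite big_ord_recr /=; have := G_step jm; rewrite IH ?(ltnW jm) //.
  set T := \sum_(_ < _) _; set z := x ^+ _ * _ => eG.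
  have -> : G (m - j.+1) = (1 + (1 - q) * T) * G m - (q - 1) * z * G m.
    by rewrite -eG; ring.
  by ring.
have G0 : G 0%N = (1 + (1 - q) * (S m.+1 - 1)) * G m.
  by rewrite S_recl [X in X - 1]addrC addrK -G_sub // subnn.
(* By [SE], the subtracted term of [num] is [q * (S m.+1 - 1)]. *)
move=> num; have numE : num = 1 + (1 - q) * (S m.+1 - 1).
  by rewrite /num SE; ring.
rewrite numE -G0; split=> //; rewrite mulrDl -[(1 - x * t) * _ * _]mulrA -G0.
rewrite -exponent_diag exponentS // subSnn addn1.
have := G_rec (leq0n m); rewrite big_ord0 expr1 addr0.
(* For [m = 0] every part completes a staircase, so the equation of [G 0] itself carries q. *)
have [m0|m_gt0] := posnP m.
  have G1 := G_last; rewrite m0 in G1; rewrite m0 eqxx G1 => eG.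
  rewrite muln0 sub0n !expr1; apply: etrans (_ : G 0%N - x * t * (q * G 0%N) = _).
    by ring.
  by rewrite {1}eG addrK.
have m1 : (m - m.-1 = 1)%N by lia.
(* The last difference, [G 1 - G 0], turns [G 0 = 1 + x t G 1] into the claim. *)
have := @G_step m.-1; rewrite prednK // m1 subnn leqnn => /(_ isT) eG.
rewrite ltn_eqF // mul1r => eG0; rewrite [x ^+ _.+1]exprS [t ^+ m.+1]exprS.
set X := x ^+ _ in eG *.
transitivity ((1 - x * t) * G 0%N - x * t * ((q - 1) * (X * t ^+ m) * G m)).
  by ring.
by rewrite -eG -[RHS](addrK (x * t * G 1%N)) -eG0; ring.
Qed.
End LinearSystem.

(** * The series of the states and the closed form *)

Definition state_series m s : fps coefring :=
  comp_series (fun u => 'X ^+ size u * 'X%:P ^+ occ m s u).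

Lemma F_state_series m : (0 < m)%N -> F m = state_series m 0.
Proof.
move=> m0; congr fps_sum; apply/funext => u.
by rewrite -mulrA st_occ // /y /q !fpsC_exp fpsCM.
Qed.

Lemma state_series_cons m s : state_series m s =
  1 + shift_sum (fun a => y * q ^+ (next_state m s a.+1 == m) *
                          state_series m (next_state m s a.+1)).
Proof.
rewrite {1}/state_series comp_series_cons mulr1; congr (_ + _).
apply: eq_shift_sum => a.
rewrite /y /q fpsC_exp -fpsCM -comp_seriesZ; congr comp_series.
by apply/funext => u /=; rewrite exprS exprD; ring.
Qed.

(** After a complete staircase the next window can reuse only the last [m] parts, so both states
    have the same successors. *)
Lemma state_series_last m : state_series m.+1 m.+1 = state_series m.+1 m.
Proof.
congr comp_series; apply/funext => -[|a u] //=.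
rewrite (_ : next_state m.+1 m.+1 a = next_state m.+1 m a) //.
by rewrite /next_state; lia.
Qed.

(** A part at most [s] becomes the new state and completes nothing; all larger parts lead to [s.+1],
    whence the geometric tail, with a factor q only if [s = m]. *)
Lemma state_series_rec m s : (s <= m)%N -> state_series m.+1 s =
  1 + \sum_(a < s) x ^+ a.+1 * (y / (1 - x) * (1 - x) * state_series m.+1 a.+1)
  + x ^+ s.+1 * (y / (1 - x)) *
    ((if s == m then q else 1) * state_series m.+1 s.+1).
Proof.
move=> sm; rewrite state_series_cons (@shift_sum_stationary _ _ s) => [|a sa].
  have ns : next_state m.+1 s s.+1 = s.+1 by rewrite /next_state; lia.
  rewrite ns eqSS divrK ?onem_x_unit // -addrA; congr (_ + (_ + _)).
    apply: eq_bigr => a _; have as_ := ltn_ord a.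
    have -> : next_state m.+1 s a.+1 = a.+1 by rewrite /next_state; lia.
    by rewrite eqSS (ltn_eqF (leq_trans as_ sm)) expr0 mulr1.
  by case: eqP => _; ring.
by rewrite (_ : next_state m.+1 s a.+1 = next_state m.+1 s s.+1) // /next_state; lia.
Qed.

Unset Implicit Arguments.

Theorem theorem1 (m : nat) (hm : (1 <= m)%N) :
  let num := N m - q * x ^+ m * y / (1 - x) * N m.-1 in
  let den := (1 - q) * x ^+ 'C(m.+1, 2) * (y / (1 - x)) ^+ m
             + (1 - x - x * y) / (1 - x) * num in
  den \is a GRing.unit /\ F m = num / den.
Proof.
case: m hm => // m _ num den.
have [] := staircase_system (state_series_last m) (@state_series_rec m).
rewrite -/(N m.+1) -/(N m).
have -> : N m.+1 - q * x ^+ m.+1 * (y / (1 - x)) * N m = num.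
  by rewrite /num mulrA.
have -> : 1 - x * (y / (1 - x)) = (1 - x - x * y) / (1 - x).
  by rewrite [RHS]mulrBl divrr ?onem_x_unit // mulrA.
rewrite -/den -F_state_series // => FE den1.
(* The series of state [m] is the inverse of the denominator. *)
have den_unit : den \is a GRing.unit by apply/unitrPr; exists (state_series m.+1 m).
split=> //; rewrite FE; apply: (mulIr den_unit).
by rewrite -mulrA [_ * den]mulrC den1 mulr1 divrK.
Qed.
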